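(* For any formula $A$ of the language of $\mathsf{ILL}_\bot$, one obtains the linear Kuroda translation $A^{\rm lKu}$ from the inner Kolmogorov translation $A^{{\rm K}_i}$ by systematically applying the following formula reductions, starting from the atomic formulas and inductively applying them to composite formulas: $$\neg\neg(\neg\neg A\otimes\neg\neg B)\mapsto\neg\neg(A\otimes B),\qquad \neg\neg(\neg\neg A\oplus\neg\neg B)\mapsto\neg\neg(A\oplus B),$$ $$\neg\neg(\neg\neg A\multimap\neg\neg B)\mapsto\neg\neg(A\multimap\neg\neg B),\qquad \neg\neg\exists x\,\neg\neg A\mapsto\neg\neg\exists x\,A.$$ Hence $(\cdot)^{\rm lKu}$ is a simplification from inside of $(\cdot)^{{\rm K}_i}$ (as translations from $\mathsf{CLL}_{\rm b}$ to $\mathsf{ILL}_\bot$). Moreover, the reductions above are reversible in $\mathsf{ILL}_\bot$ (i.e. the two sides of each reduction are provably equivalent in $\mathsf{ILL}_\bot$).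
   Context: Intuitionistic linear logic $\mathsf{ILL}$ (first order). Formulas are built from atomic formulas, including the constants $1,\top,0$, using $\otimes,\&,\oplus,\multimap$, $\forall x,\exists x$ and $!$. Sequents are $\Gamma\vdash A$ with $\Gamma$ a finite multiset of formulas and exactly one formula on the right. Axioms: $A\vdash A$; $\vdash 1$; $\Gamma\vdash\top$; $\Gamma,0\vdash C$. Rules (premises $\Rightarrow$ conclusion): (cut) $\Gamma\vdash A;\ \Delta,A\vdash C\Rightarrow\Gamma,\Delta\vdash C$; $\Gamma\vdash C\Rightarrow\Gamma,1\vdash C$; $\Gamma\vdash A;\ \Delta\vdash B\Rightarrow\Gamma,\Delta\vdash A\otimes B$; $\Gamma,A,B\vdash C\Rightarrow\Gamma,A\otimes B\vdash C$; $\Gamma,A\vdash B\Rightarrow\Gamma\vdash A\multimap B$; $\Gamma\vdash A;\ \Delta,B\vdash C\Rightarrow\Gamma,\Delta,A\multimap B\vdash C$; $\Gamma\vdash A;\ \Gamma\vdash B\Rightarrow\Gamma\vdash A\& B$; $\Gamma,A\vdash C\Rightarrow\Gamma,A\& B\vdash C$; $\Gamma,B\vdash C\Rightarrow\Gamma,A\& B\vdash C$; $\Gamma\vdash A\Rightarrow\Gamma\vdash A\oplus B$; $\Gamma\vdash B\Rightarrow\Gamma\vdash A\oplus B$; $\Gamma,A\vdash C;\ \Gamma,B\vdash C\Rightarrow\Gamma,A\oplus B\vdash C$; $\Gamma\vdash A\Rightarrow\Gamma\vdash\forall xA$; $\Gamma,A[t/x]\vdash C\Rightarrow\Gamma,\forall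 xA\vdash C$; $\Gamma\vdash A[t/x]\Rightarrow\Gamma\vdash\exists xA$; $\Gamma,A\vdash C\Rightarrow\Gamma,\exists xA\vdash C$ (usual eigenvariable conditions); $\Gamma,!A,!A\vdash C\Rightarrow\Gamma,!A\vdash C$; $\Gamma\vdash C\Rightarrow\Gamma,!A\vdash C$; $!\Gamma\vdash A\Rightarrow\,!\Gamma\vdash\,!A$; $\Gamma,A\vdash C\Rightarrow\Gamma,!A\vdash C$. $\mathsf{ILL}_\bot$ extends $\mathsf{ILL}$ by one more constant $\bot$ (also counted as atomic); its sequents have at most one formula on the right (so $C$ in the rules above may be absent), and it has the additional axiom $\bot\vdash$ and rule $\Gamma\vdash\ \Rightarrow\Gamma\vdash\bot$. $\neg A:=A\multimap\bot$. $\mathsf{DNE}$: $\neg\neg A\vdash A$ (axiom schema). $\mathsf{CLL}_{\rm b}:=\mathsf{ILL}_\bot+\mathsf{DNE}$. Formulas $A,B$ are equivalent over $S$ if $S$ proves $(A\multimap B)\&(B\multimap A)$. Translations. Throughout $\square\in\{\otimes,\&,\oplus,\multimap\}$, $Q\in\{\forall x,\exists x,!\}$. Inner Kolmogorov: $A^{{\rm K}_i}:=\neg\neg A_{{\rm K}_i}$ where $P_{{\rm K}_i}:=P$ ($P$ atomic), $(A\,\square\,B)_{{\rm K}_i}:=\neg\neg A_{{\rm K}_i}\,\square\,\neg\neg B_{{\rm K}_i}$, $(QA)_{{\rm K}_i}:=Q\,\neg\neg A_{{\rm K}_i}$. Linear Kuroda: $A^{\rm lKu}:=\neg\neg A_{\rm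 lKu}$ where $P_{\rm lKu}:=P$ ($P$ atomic); $(A\otimes B)_{\rm lKu}:=A_{\rm lKu}\otimes B_{\rm lKu}$; $(A\& B)_{\rm lKu}:=\neg\neg A_{\rm lKu}\&\neg\neg B_{\rm lKu}$; $(A\oplus B)_{\rm lKu}:=A_{\rm lKu}\oplus B_{\rm lKu}$; $(A\multimap B)_{\rm lKu}:=A_{\rm lKu}\multimap\neg\neg B_{\rm lKu}$; $(\forall xA)_{\rm lKu}:=\forall x\,\neg\neg A_{\rm lKu}$; $(\exists xA)_{\rm lKu}:=\exists xA_{\rm lKu}$; $(!A)_{\rm lKu}:=\,!\,\neg\neg A_{\rm lKu}$. General notions, for a formula construct $T$ (here $T(A)=\neg\neg A$). A $T$-based inner-transform is $\mathcal T_\square(A,B)=T'(A)\,\square\,T''(B)$, resp. $\mathcal T_Q(A)=Q(T'(A))$, with $T',T''\in\{T,\mathrm{Id}\}$. A modular inner $T$-translation is one of the form $A^{\rm Tr}:=T(A_{\rm Tr})$ with $P_{\rm Tr}:=P$ ($P$ atomic), $(A\,\square\,B)_{\rm Tr}:=\mathcal T^{\rm Tr}_\square(A_{\rm Tr},B_{\rm Tr})$, $(QA)_{\rm Tr}:=\mathcal T^{\rm Tr}_Q(A_{\rm Tr})$ for inner-transforms $\mathcal T^{\rm Tr}$. A transform is simpler than another one for the same connective, quantifier or modality if the latter uses $T$ in all places where the former does, but not conversely. A translation is sound from $S_1$ to $S_2$ if for all $A$: $\vdash_{S_1}A$ implies $\vdash_{S_2}A^{\rm Tr}$, and $A$, $A^{\rm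 Tr}$ are equivalent over $S_1$. Two sound translations from $S_1$ to $S_2$ are equivalent if $A^{\rm Tr}$ and $A^{{\rm Tr}'}$ are equivalent over $S_2$ for all $A$. For equivalent translations, ${\rm Tr}'$ is a simplification of ${\rm Tr}$ if each transform of ${\rm Tr}'$ is identical to or simpler than the corresponding one of ${\rm Tr}$, and simpler in at least one case. For two equivalent modular inner $T$-translations, ${\rm Tr}'$ is a simplification from inside of ${\rm Tr}$ if it is a simplification of ${\rm Tr}$ and $A^{{\rm Tr}'}$ is obtained from $A^{\rm Tr}$ by applying the reductions $T(\mathcal T^{\rm Tr}_\square(A,B))\mapsto T(\mathcal T^{{\rm Tr}'}_\square(A,B))$ and $T(\mathcal T^{\rm Tr}_Q(A))\mapsto T(\mathcal T^{{\rm Tr}'}_Q(A))$ inductively, starting from the atomic formulas and working towards the whole formula (first reducing the parts that are translations of the immediate subformulas, then applying the reduction matching the resulting whole formula, if there is one). *)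

(* Defs.v *)
From Stdlib Require Vector.
From Stdlib Require Import List Permutation.
Import ListNotations.
Set Implicit Arguments.

(** * First-order formulas of ILL_bot

    Binders are in de Bruijn style: [Un All A] and [Un Ex A] bind index 0 in
    [A], so formulas are taken up to renaming of bound variables. *)

Record signature := Signature {
  fun_sym : Type;
  fun_arity : fun_sym -> nat;
  pred_sym : Type;
  pred_arity : pred_sym -> nat }.

Inductive term (Sg : signature) : Type :=
| Var (n : nat)
| App (f : fun_sym Sg) (ts : Vector.t (term Sg) (fun_arity Sg f)).
Arguments Var {Sg} n.

Inductive atom (Sg : signature) : Type :=
| Pred (p : pred_sym Sg) (ts : Vector.t (term Sg) (pred_arity Sg p))
| One | Top | Zero | Bot.
Arguments One {Sg}.
Arguments Top {Sg}.
Arguments Zero {Sg}.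
Arguments Bot {Sg}.

Inductive binop : Type := Tensor | With | Plus | Lolli.
Inductive unop : Type := All | Ex | Bang.

Inductive form (Sg : signature) : Type :=
| Atom (P : atom Sg)
| Bin (o : binop) (A B : form Sg)
| Un (q : unop) (A : form Sg).

Declare Scope ill_scope.
Delimit Scope ill_scope with ill.
Bind Scope ill_scope with form.
Open Scope ill_scope.
Notation "A ⊗ B" := (Bin Tensor A B) (at level 40, left associativity) : ill_scope.
Notation "A && B" := (Bin With A B) (at level 40, left associativity) : ill_scope.
Notation "A ⊕ B" := (Bin Plus A B) (at level 50, left associativity) : ill_scope.
Notation "A ⊸ B" := (Bin Lolli A B) (at level 55, right associativity) : ill_scope.

Definition neg {Sg} (A : form Sg) : form Sg := A ⊸ Atom Bot.
Notation "¬ A" := (neg A) (at level 35, right associativity) : ill_scope.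

Definition neg2 {Sg} (A : form Sg) : form Sg := ¬ ¬ A.

Fixpoint subst_term {Sg} (s : nat -> term Sg) (t : term Sg) : term Sg :=
  match t with
  | Var n => s n
  | @App _ f ts => App f (Vector.map (subst_term s) ts)
  end.

Definition shift_term {Sg} : term Sg -> term Sg :=
  subst_term (fun n => Var (S n)).

Definition lift_subst {Sg} (s : nat -> term Sg) (n : nat) : term Sg :=
  match n with
  | 0 => Var 0
  | S k => shift_term (s k)
  end.

Definition subst_atom {Sg} (s : nat -> term Sg) (P : atom Sg) : atom Sg :=
  match P with
  | @Pred _ p ts => Pred p (Vector.map (subst_term s) ts)
  | One => One
  | Top => Top
  | Zero => Zero
  | Bot => Bot
  end.

Fixpoint subst {Sg} (s : nat -> term Sg) (A : form Sg) : form Sg :=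
  match A with
  | Atom P => Atom (subst_atom s P)
  | Bin o A B => Bin o (subst s A) (subst s B)
  | Un Bang A => Un Bang (subst s A)
  | Un q A => Un q (subst (lift_subst s) A)
  end.

Definition shift {Sg} : form Sg -> form Sg := subst (fun n => Var (S n)).

(** [inst t A] is A[t/x] for the variable x bound by a quantifier over [A]. *)
Definition inst {Sg} (t : term Sg) : form Sg -> form Sg :=
  subst (fun n => match n with 0 => t | S k => Var k end).

(** * Sequent calculus

    [derivable Ax] is ILL_bot extended by the axioms [Ax].  Multisets are lists
    up to the rule [d_perm]; [None] is the empty right-hand side.  The
    eigenvariable conditions of [d_allR] and [d_exL] are expressed by shifting
    the side formulas, so that index 0 is fresh for them. *)

Definition system (Sg : signature) : Type :=
  list (form Sg) -> option (form Sg) -> Prop.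

Inductive derivable {Sg} (Ax : system Sg) : system Sg :=
| d_ax Γ C : Ax Γ C -> derivable Ax Γ C
| d_perm Γ Δ C : Permutation Γ Δ -> derivable Ax Γ C -> derivable Ax Δ C
| d_id A : derivable Ax [A] (Some A)
| d_cut Γ Δ A C :
    derivable Ax Γ (Some A) -> derivable Ax (A :: Δ) C ->
    derivable Ax (Γ ++ Δ) C
| d_oneR : derivable Ax [] (Some (Atom One))
| d_oneL Γ C : derivable Ax Γ C -> derivable Ax (Atom One :: Γ) C
| d_topR Γ : derivable Ax Γ (Some (Atom Top))
| d_zeroL Γ C : derivable Ax (Atom Zero :: Γ) C
| d_botL : derivable Ax [Atom Bot] None
| d_botR Γ : derivable Ax Γ None -> derivable Ax Γ (Some (Atom Bot))
| d_tensorR Γ Δ A B :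
    derivable Ax Γ (Some A) -> derivable Ax Δ (Some B) ->
    derivable Ax (Γ ++ Δ) (Some (A ⊗ B))
| d_tensorL Γ A B C :
    derivable Ax (A :: B :: Γ) C -> derivable Ax (A ⊗ B :: Γ) C
| d_lolliR Γ A B :
    derivable Ax (A :: Γ) (Some B) -> derivable Ax Γ (Some (A ⊸ B))
| d_lolliL Γ Δ A B C :
    derivable Ax Γ (Some A) -> derivable Ax (B :: Δ) C ->
    derivable Ax ((A ⊸ B) :: Γ ++ Δ) C
| d_withR Γ A B :
    derivable Ax Γ (Some A) -> derivable Ax Γ (Some B) ->
    derivable Ax Γ (Some (A && B))
| d_withL1 Γ A B C : derivable Ax (A :: Γ) C -> derivable Ax (A && B :: Γ) C
| d_withL2 Γ A B C : derivable Ax (B :: Γ) C -> derivable Ax (A && B :: Γ) C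
| d_plusR1 Γ A B :
    derivable Ax Γ (Some A) -> derivable Ax Γ (Some (A ⊕ B))
| d_plusR2 Γ A B :
    derivable Ax Γ (Some B) -> derivable Ax Γ (Some (A ⊕ B))
| d_plusL Γ A B C :
    derivable Ax (A :: Γ) C -> derivable Ax (B :: Γ) C ->
    derivable Ax ((A ⊕ B) :: Γ) C
| d_allR Γ A :
    derivable Ax (map shift Γ) (Some A) -> derivable Ax Γ (Some (Un All A))
| d_allL Γ A t C :
    derivable Ax (inst t A :: Γ) C -> derivable Ax (Un All A :: Γ) C
| d_exR Γ A t :
    derivable Ax Γ (Some (inst t A)) -> derivable Ax Γ (Some (Un Ex A))
| d_exL Γ A C :
    derivable Ax (A :: map shift Γ) (option_map shift C) ->
    derivable Ax (Un Ex A :: Γ) C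
| d_bangC Γ A C :
    derivable Ax (Un Bang A :: Un Bang A :: Γ) C ->
    derivable Ax (Un Bang A :: Γ) C
| d_bangW Γ A C : derivable Ax Γ C -> derivable Ax (Un Bang A :: Γ) C
| d_bangR Γ A :
    derivable Ax (map (Un Bang) Γ) (Some A) ->
    derivable Ax (map (Un Bang) Γ) (Some (Un Bang A))
| d_bangL Γ A C : derivable Ax (A :: Γ) C -> derivable Ax (Un Bang A :: Γ) C.

Inductive DNE {Sg} : system Sg :=
| dne A : DNE [¬ ¬ A] (Some A).

Definition ILLbot (Sg : signature) : system Sg := derivable (fun _ _ => False).
Definition CLLb (Sg : signature) : system Sg := derivable DNE.
Arguments ILLbot Sg _ _ : clear implicits.
Arguments CLLb Sg _ _ : clear implicits.

Definition equivalent {Sg} (S : system Sg) (A B : form Sg) : Prop :=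
  S [] (Some ((A ⊸ B) && (B ⊸ A))).

(** * The two translations *)

Fixpoint Ki_in {Sg} (A : form Sg) : form Sg :=
  match A with
  | Atom P => Atom P
  | Bin o A B => Bin o (¬ ¬ Ki_in A) (¬ ¬ Ki_in B)
  | Un q A => Un q (¬ ¬ Ki_in A)
  end.

Definition Ki {Sg} (A : form Sg) : form Sg := ¬ ¬ Ki_in A.

Fixpoint lKu_in {Sg} (A : form Sg) : form Sg :=
  match A with
  | Atom P => Atom P
  | A ⊗ B => lKu_in A ⊗ lKu_in B
  | A && B => (¬ ¬ lKu_in A) && (¬ ¬ lKu_in B)
  | A ⊕ B => lKu_in A ⊕ lKu_in B
  | A ⊸ B => lKu_in A ⊸ ¬ ¬ lKu_in B
  | Un All A => Un All (¬ ¬ lKu_in A)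
  | Un Ex A => Un Ex (lKu_in A)
  | Un Bang A => Un Bang (¬ ¬ lKu_in A)
  end.

Definition lKu {Sg} (A : form Sg) : form Sg := ¬ ¬ lKu_in A.

(** * Modular inner translations

    An inner-transform is given by the choice, at each argument place, of the
    construct T or the identity. *)

Inductive slot : Type := UseT | UseId.

Definition fill {Sg} (T : form Sg -> form Sg) (s : slot) (A : form Sg) : form Sg :=
  match s with UseT => T A | UseId => A end.

Record transforms := Transforms {
  bin_slots : binop -> slot * slot;
  un_slot : unop -> slot }.

Definition bin_transform {Sg} (T : form Sg -> form Sg) (m : transforms)
    (o : binop) (A B : form Sg) : form Sg :=
  Bin o (fill T (fst (bin_slots m o)) A) (fill T (snd (bin_slots m o)) B).

Definition un_transform {Sg} (T : form Sg -> form Sg) (m : transforms)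
    (q : unop) (A : form Sg) : form Sg :=
  Un q (fill T (un_slot m q) A).

Definition modular_inner {Sg} (T : form Sg -> form Sg) (m : transforms)
    (Tr : form Sg -> form Sg) : Prop :=
  exists Tr_in : form Sg -> form Sg,
    (forall A, Tr A = T (Tr_in A)) /\
    (forall P, Tr_in (Atom P) = Atom P) /\
    (forall o A B, Tr_in (Bin o A B) = bin_transform T m o (Tr_in A) (Tr_in B)) /\
    (forall q A, Tr_in (Un q A) = un_transform T m q (Tr_in A)).

Definition Ki_transforms : transforms :=
  Transforms (fun _ => (UseT, UseT)) (fun _ => UseT).

Definition lKu_transforms : transforms :=
  Transforms
    (fun o => match o with
              | Tensor => (UseId, UseId)
              | With => (UseT, UseT)
              | Plus => (UseId, UseId)
              | Lolli => (UseId, UseT)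
              end)
    (fun q => match q with
              | All => UseT
              | Ex => UseId
              | Bang => UseT
              end).

Definition bin_covers (p p' : slot * slot) : Prop :=
  (fst p' = UseT -> fst p = UseT) /\ (snd p' = UseT -> snd p = UseT).

Definition un_covers (s s' : slot) : Prop := s' = UseT -> s = UseT.

Definition bin_simpler (p' p : slot * slot) : Prop :=
  bin_covers p p' /\ ~ bin_covers p' p.

Definition un_simpler (s' s : slot) : Prop :=
  un_covers s s' /\ ~ un_covers s' s.

(** * Comparing translations *)

Definition sound {Sg} (S1 S2 : system Sg) (Tr : form Sg -> form Sg) : Prop :=
  (forall A, S1 [] (Some A) -> S2 [] (Some (Tr A))) /\
  (forall A, equivalent S1 A (Tr A)).

Definition equivalent_translations {Sg} (S1 S2 : system Sg)
    (Tr Tr' : form Sg -> form Sg) : Prop :=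
  sound S1 S2 Tr /\ sound S1 S2 Tr' /\
  (forall A, equivalent S2 (Tr A) (Tr' A)).

(** [Tr'], with transforms [m'], is a simplification of [Tr], with transforms [m]. *)
Definition simplification {Sg} (S1 S2 : system Sg) (T : form Sg -> form Sg)
    (m' : transforms) (Tr' : form Sg -> form Sg)
    (m : transforms) (Tr : form Sg -> form Sg) : Prop :=
  modular_inner T m' Tr' /\ modular_inner T m Tr /\
  equivalent_translations S1 S2 Tr Tr' /\
  (forall o, bin_slots m' o = bin_slots m o \/
             bin_simpler (bin_slots m' o) (bin_slots m o)) /\
  (forall q, un_slot m' q = un_slot m q \/
             un_simpler (un_slot m' q) (un_slot m q)) /\
  ((exists o, bin_simpler (bin_slots m' o) (bin_slots m o)) \/
   (exists q, un_simpler (un_slot m' q) (un_slot m q))).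

(** * Reducing a translated formula from inside *)

(** Apply at the root a reduction of [Red] that matches, if there is one. *)
Definition root_step {Sg} (Red : form Sg -> form Sg -> Prop) (X Y : form Sg) : Prop :=
  Red X Y \/ ((forall Z, ~ Red X Z) /\ Y = X).

(** [reduces_part T m Red UseT A X Y]: [X] is the modular inner T-translation
    of [A] with transforms [m], and [Y] results from [X] by first reducing in
    this way the parts of [X] that are translations of the immediate
    subformulas of [A], and then reducing at the root.  The subformula
    structure of [A] determines which parts of [X] are reduced.  Where [m] has
    no T in front of a subformula, that part is not of the form T(...), so there
    is no step at its root and only its own parts are reduced ([UseId]). *)
Inductive reduces_part {Sg} (T : form Sg -> form Sg) (m : transforms)
    (Red : form Sg -> form Sg -> Prop) :
    slot -> form Sg -> form Sg -> form Sg -> Prop :=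
| rp_T A X X' Y :
    reduces_part T m Red UseId A X X' -> root_step Red (T X') Y ->
    reduces_part T m Red UseT A (T X) Y
| rp_atom P : reduces_part T m Red UseId (Atom P) (Atom P) (Atom P)
| rp_bin o A B X X' Y Y' :
    reduces_part T m Red (fst (bin_slots m o)) A X X' ->
    reduces_part T m Red (snd (bin_slots m o)) B Y Y' ->
    reduces_part T m Red UseId (Bin o A B) (Bin o X Y) (Bin o X' Y')
| rp_un q A X X' :
    reduces_part T m Red (un_slot m q) A X X' ->
    reduces_part T m Red UseId (Un q A) (Un q X) (Un q X').

Definition reduces_from_inside {Sg} (T : form Sg -> form Sg) (m : transforms)
    (Red : form Sg -> form Sg -> Prop) (A X Y : form Sg) : Prop :=
  reduces_part T m Red UseT A X Y.

Inductive transform_reduction {Sg} (T : form Sg -> form Sg) (m m' : transforms) :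
    form Sg -> form Sg -> Prop :=
| tr_bin o A B :
    transform_reduction T m m'
      (T (bin_transform T m o A B)) (T (bin_transform T m' o A B))
| tr_un q A :
    transform_reduction T m m'
      (T (un_transform T m q A)) (T (un_transform T m' q A)).

Definition simplification_from_inside {Sg} (S1 S2 : system Sg)
    (T : form Sg -> form Sg)
    (m' : transforms) (Tr' : form Sg -> form Sg)
    (m : transforms) (Tr : form Sg -> form Sg) : Prop :=
  simplification S1 S2 T m' Tr' m Tr /\
  (forall A, reduces_from_inside T m (transform_reduction T m m') A (Tr A) (Tr' A)).

Inductive kuroda_reduction {Sg} : form Sg -> form Sg -> Prop :=
| kr_tensor A B : kuroda_reduction (¬ ¬ (¬ ¬ A ⊗ ¬ ¬ B)) (¬ ¬ (A ⊗ B))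
| kr_plus A B : kuroda_reduction (¬ ¬ (¬ ¬ A ⊕ ¬ ¬ B)) (¬ ¬ (A ⊕ B))
| kr_lolli A B : kuroda_reduction (¬ ¬ (¬ ¬ A ⊸ ¬ ¬ B)) (¬ ¬ (A ⊸ ¬ ¬ B))
| kr_ex A : kuroda_reduction (¬ ¬ Un Ex (¬ ¬ A)) (¬ ¬ Un Ex A).

(* Main.v *)
(** The translation [lKu] is sound in a Kuroda-style form: a [CLLb]-derivation
    of Γ ⊢ C becomes an [ILLbot]-derivation of Γ_lKu ⊢ ¬¬C_lKu, because a
    hypothesis A may be replaced by ¬¬A whenever the conclusion is doubly
    negated, and the double negations kept in front of the arguments of &, ∀, !
    and of the right argument of ⊸ are exactly those which the right rules of
    these connectives need.  The same replacement of A by ¬¬A makes the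
    reductions reversible; hence A^Ki and A^lKu are equivalent, and soundness of
    the Kolmogorov translation follows from that of the Kuroda translation. *)

From Stdlib Require Import List Permutation.
Require Import Defs.
Import ListNotations.

Notation "Γ ⊢[ Ax ] C" := (derivable Ax Γ (Some C))
  (at level 70, Ax at level 0, no associativity).

(** * Substitution *)

Lemma subst_term_comp {Sg} (r s u : nat -> term Sg) :
  (forall n, subst_term s (r n) = u n) ->
  forall t, subst_term s (subst_term r t) = subst_term u t.
Proof.
  (* Terms are nested in vectors: [fix] provides the hypothesis for all arguments, and an inner
     induction on [ts] consumes it. *)
  intros H. fix IH 1. intros [n|f ts]; [apply H|]. simpl. f_equal.
  induction ts as [|t n ts IHts]; simpl; f_equal; auto.
Qed.

Lemma subst_term_id {Sg} (s : nat -> term Sg) :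
  (forall n, s n = Var n) -> forall t, subst_term s t = t.
Proof.
  intros H. fix IH 1. intros [n|f ts]; [apply H|]. simpl. f_equal.
  induction ts as [|t n ts IHts]; simpl; f_equal; auto.
Qed.

Lemma subst_term_lift_shift {Sg} (s : nat -> term Sg) t :
  subst_term (lift_subst s) (shift_term t) = shift_term (subst_term s t).
Proof.
  unfold shift_term.
  rewrite !(subst_term_comp _ _ (fun n => shift_term (s n))); reflexivity.
Qed.

(** [r] and [s] stay quantified in the induction because both are lifted under a quantifier; lifting
    preserves the pointwise inverse relation. *)
Lemma subst_cancel {Sg} (A : form Sg) : forall r s,
  (forall n, subst_term s (r n) = Var n) -> subst s (subst r A) = A.
Proof.
  induction A as [P|o A IHA B IHB|q A IHA]; intros r s H; simpl.
  - f_equal. destruct P as [p ts| | | |]; try reflexivity. simpl. f_equal.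
    induction ts as [|t n ts IHts]; simpl; f_equal; auto.
    rewrite (subst_term_comp _ _ Var); auto. apply subst_term_id. auto.
  - f_equal; auto.
  - assert (Hl : forall n,
               subst_term (lift_subst s) (lift_subst r n) = Var n).
    { intros [|n]; [reflexivity|]. cbn [lift_subst].
      rewrite subst_term_lift_shift, H. reflexivity. }
    destruct q; simpl; f_equal; auto.
Qed.

(** Lets a shifted quantified formula be instantiated at the eigenvariable, which has index 0. *)
Lemma inst_var0_lift {Sg} (A : form Sg) :
  inst (Var 0) (subst (lift_subst (fun n => Var (S n))) A) = A.
Proof. apply subst_cancel. intros [|n]; reflexivity. Qed.

(** The translation only inserts negations, and ⊥ is closed. The quantifier rules of
    [lKu_derivation] rely on this. *)
Lemma lKu_in_subst {Sg} (A : form Sg) :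
  forall s, lKu_in (subst s A) = subst s (lKu_in A).
Proof.
  induction A as [P|o A IHA B IHB|q A IHA]; intros s; [reflexivity| |].
  - destruct o; simpl; rewrite IHA, IHB; reflexivity.
  - destruct q; simpl; rewrite IHA; reflexivity.
Qed.

Lemma lKu_in_map_shift {Sg} (Γ : list (form Sg)) :
  map lKu_in (map shift Γ) = map shift (map lKu_in Γ).
Proof.
  rewrite !map_map. apply map_ext. intros A. apply lKu_in_subst.
Qed.

(** * Derived rules *)

Lemma derivable_swap {Sg} (Ax : system Sg) Γ A B C :
  derivable Ax (A :: B :: Γ) C -> derivable Ax (B :: A :: Γ) C.
Proof. apply d_perm, perm_swap. Qed.

Lemma derivable_hyp {Sg} (Ax : system Sg) Γ A B C :
  [A] ⊢[Ax] B -> derivable Ax (B :: Γ) C -> derivable Ax (A :: Γ) C.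
Proof. apply (@d_cut _ _ [A]). Qed.

Lemma lolli_inv {Sg} (Ax : system Sg) Γ A B :
  Γ ⊢[Ax] (A ⊸ B) -> A :: Γ ⊢[Ax] B.
Proof.
  intros H. apply d_perm with (Γ ++ [A]).
  - apply Permutation_sym, Permutation_cons_append.
  - eapply d_cut; [exact H|]. apply (@d_lolliL _ _ [A] []); apply d_id.
Qed.

Lemma neg2_intro {Sg} (Ax : system Sg) Γ A : Γ ⊢[Ax] A -> Γ ⊢[Ax] ¬ ¬ A.
Proof.
  intros H. apply d_lolliR. rewrite <- (app_nil_r Γ).
  apply d_lolliL; [exact H|apply d_id].
Qed.

(** Bind of the continuation monad with answer ⊥: the premise and [¬ C] refute [A], contradicting
    [¬ ¬ A]. Each hypothesis is used once, so the argument is linear. *)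
Lemma neg2_bind {Sg} (Ax : system Sg) Γ A C :
  A :: Γ ⊢[Ax] ¬ ¬ C -> ¬ ¬ A :: Γ ⊢[Ax] ¬ ¬ C.
Proof.
  intros H. apply d_lolliR, derivable_swap.
  rewrite <- (app_nil_r (_ :: Γ)). apply d_lolliL; [|apply d_id].
  apply d_lolliR, derivable_swap, lolli_inv, H.
Qed.

Lemma neg2_cut {Sg} (Ax : system Sg) Γ Δ A C :
  Γ ⊢[Ax] ¬ ¬ A -> A :: Δ ⊢[Ax] ¬ ¬ C -> Γ ++ Δ ⊢[Ax] ¬ ¬ C.
Proof. intros H1 H2. eapply d_cut; [exact H1|apply neg2_bind, H2]. Qed.

Lemma neg2_map {Sg} (Ax : system Sg) Γ A B :
  Γ ⊢[Ax] ¬ ¬ A -> [A] ⊢[Ax] B -> Γ ⊢[Ax] ¬ ¬ B.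
Proof.
  intros H1 H2. rewrite <- (app_nil_r Γ).
  eapply neg2_cut; [exact H1|apply neg2_intro, H2].
Qed.

(** The two arguments are unwrapped one after the other under the doubly negated goal. *)
Lemma neg2_tensor {Sg} (Ax : system Sg) Γ Δ A B :
  Γ ⊢[Ax] ¬ ¬ A -> Δ ⊢[Ax] ¬ ¬ B -> Γ ++ Δ ⊢[Ax] ¬ ¬ (A ⊗ B).
Proof.
  intros HA HB. eapply neg2_cut; [exact HA|].
  apply d_perm with (Δ ++ [A]).
  - apply Permutation_sym, Permutation_cons_append.
  - eapply neg2_cut; [exact HB|]. apply derivable_swap, neg2_intro.
    apply (@d_tensorR _ _ [A] [B]); apply d_id.
Qed.

(** The implication expects a bare [A]; as the goal is doubly negated, [¬ ¬ A] is unwrapped first,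
    then the resulting [¬ ¬ B]. *)
Lemma neg2_lolliL {Sg} (Ax : system Sg) Γ Δ A B C :
  Γ ⊢[Ax] ¬ ¬ A -> B :: Δ ⊢[Ax] ¬ ¬ C ->
  (A ⊸ ¬ ¬ B) :: Γ ++ Δ ⊢[Ax] ¬ ¬ C.
Proof.
  intros HA HB. apply d_perm with (Γ ++ (A ⊸ ¬ ¬ B) :: Δ).
  - apply Permutation_sym, Permutation_middle.
  - eapply neg2_cut; [exact HA|]. apply derivable_swap.
    apply (@d_lolliL _ _ [A]); [apply d_id|]. apply neg2_bind, HB.
Qed.

Lemma exists_intro {Sg} (Ax : system Sg) (A : form Sg) :
  [A] ⊢[Ax] shift (Un Ex A).
Proof.
  apply d_exR with (Var 0). fold (@subst Sg). rewrite inst_var0_lift. apply d_id.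
Qed.

Lemma forall_elim {Sg} (Ax : system Sg) (A : form Sg) :
  [shift (Un All A)] ⊢[Ax] A.
Proof.
  apply d_allL with (Var 0). fold (@subst Sg). rewrite inst_var0_lift. apply d_id.
Qed.

(** * Equivalence *)

Lemma equivalent_iff {Sg} (Ax : system Sg) A B :
  equivalent (derivable Ax) A B <-> [A] ⊢[Ax] B /\ [B] ⊢[Ax] A.
Proof.
  unfold equivalent. split.
  - intros H. split; apply lolli_inv; rewrite <- (app_nil_l []);
      (eapply d_cut; [exact H|]).
    + apply d_withL1, d_id.
    + apply d_withL2, d_id.
  - intros [H1 H2]. apply d_withR; apply d_lolliR; assumption.
Qed.

Lemma equivalent_refl {Sg} (Ax : system Sg) A : equivalent (derivable Ax) A A.
Proof. apply equivalent_iff. split; apply d_id. Qed.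

Lemma equivalent_trans {Sg} (Ax : system Sg) A B C :
  equivalent (derivable Ax) A B -> equivalent (derivable Ax) B C ->
  equivalent (derivable Ax) A C.
Proof.
  rewrite !equivalent_iff. intros [] [].
  split; apply derivable_hyp with B; assumption.
Qed.

Lemma equivalent_sym {Sg} (Ax : system Sg) A B :
  equivalent (derivable Ax) A B -> equivalent (derivable Ax) B A.
Proof. rewrite !equivalent_iff. tauto. Qed.

(** Equivalences are assumed, not mere entailments, because ⊸ is contravariant on the left. *)
Lemma entails_bin {Sg} (Ax : system Sg) o A A' B B' :
  equivalent (derivable Ax) A A' -> equivalent (derivable Ax) B B' ->
  [Bin o A B] ⊢[Ax] Bin o A' B'.
Proof.
  rewrite !equivalent_iff. intros [HA HA'] [HB HB']. destruct o.
  - apply d_tensorL. apply (@d_tensorR _ _ [A] [B]); assumption.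
  - apply d_withR; [apply d_withL1|apply d_withL2]; assumption.
  - apply d_plusL; [apply d_plusR1|apply d_plusR2]; assumption.
  - apply d_lolliR, derivable_swap.
    apply (@d_lolliL _ _ [A'] []); assumption.
Qed.

Lemma entails_un {Sg} (Ax : system Sg) q A A' :
  [A] ⊢[Ax] A' -> [Un q A] ⊢[Ax] Un q A'.
Proof.
  intros H. destruct q.
  - apply d_allR. apply derivable_hyp with A; [apply forall_elim|exact H].
  - apply d_exL. apply derivable_hyp with A'; [exact H|apply exists_intro].
  - apply (@d_bangR _ _ [A]), d_bangL, H.
Qed.

Lemma equivalent_bin {Sg} (Ax : system Sg) o A A' B B' :
  equivalent (derivable Ax) A A' -> equivalent (derivable Ax) B B' ->
  equivalent (derivable Ax) (Bin o A B) (Bin o A' B').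
Proof.
  intros HA HB. apply equivalent_iff.
  split; apply entails_bin; auto using equivalent_sym.
Qed.

Lemma equivalent_un {Sg} (Ax : system Sg) q A A' :
  equivalent (derivable Ax) A A' ->
  equivalent (derivable Ax) (Un q A) (Un q A').
Proof.
  rewrite !equivalent_iff. intros []. split; apply entails_un; assumption.
Qed.

Lemma equivalent_neg2 {Sg} (Ax : system Sg) A A' :
  equivalent (derivable Ax) A A' ->
  equivalent (derivable Ax) (¬ ¬ A) (¬ ¬ A').
Proof.
  intros H. do 2 (apply equivalent_bin; [|apply equivalent_refl]). exact H.
Qed.

Lemma neg2_equivalent {Sg} (Ax : system Sg) A B :
  [A] ⊢[Ax] ¬ ¬ B -> [B] ⊢[Ax] ¬ ¬ A ->
  equivalent (derivable Ax) (¬ ¬ A) (¬ ¬ B).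
Proof.
  intros H1 H2. apply equivalent_iff. split; apply neg2_bind; assumption.
Qed.

(** * The reductions *)

(** For ⊗, ⊕ and ∃, unwrapping under the outer double negation strips the inner ones and the unit
    [A ⊢ ¬ ¬ A] restores them. For ⊸ the roles swap by contravariance: the unit strips, [neg2_bind]
    restores. *)
Lemma kuroda_reduction_equivalent {Sg} (Ax : system Sg) X Y :
  kuroda_reduction X Y -> equivalent (derivable Ax) X Y.
Proof.
  assert (unit : forall A, [A] ⊢[Ax] ¬ ¬ A) by (intros; apply neg2_intro, d_id).
  intros []; apply neg2_equivalent.
  - apply d_tensorL. apply (@neg2_tensor _ _ [_] [_]); apply d_id.
  - apply neg2_intro, d_tensorL. apply (@d_tensorR _ _ [_] [_]); apply unit.
  - apply d_plusL; eapply neg2_map; try apply d_id.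
    + apply d_plusR1, d_id.
    + apply d_plusR2, d_id.
  - apply neg2_intro, d_plusL; [apply d_plusR1|apply d_plusR2]; apply unit.
  - apply neg2_intro, d_lolliR, derivable_swap.
    apply (@d_lolliL _ _ [_] []); [apply unit|apply d_id].
  - apply neg2_intro, d_lolliR, neg2_bind, lolli_inv, d_id.
  - apply d_exL. eapply neg2_map; [apply d_id|apply exists_intro].
  - apply neg2_intro, entails_un, unit.
Qed.

(** The induction mirrors reducing from inside: congruence treats the subformulas, then one
    reduction acts at the root; for &, ∀ and ! the two sides already agree. *)
Lemma Ki_lKu_equivalent {Sg} (Ax : system Sg) A :
  equivalent (derivable Ax) (Ki A) (lKu A).
Proof.
  unfold Ki, lKu. induction A as [P|o A IHA B IHB|q A IHA].
  - apply equivalent_refl.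
  - apply equivalent_trans with (¬ ¬ Bin o (¬ ¬ lKu_in A) (¬ ¬ lKu_in B)).
    + apply equivalent_neg2, equivalent_bin; assumption.
    + destruct o; try apply equivalent_refl;
        apply kuroda_reduction_equivalent; constructor.
  - apply equivalent_trans with (¬ ¬ Un q (¬ ¬ lKu_in A)).
    + apply equivalent_neg2, equivalent_un; assumption.
    + destruct q; try apply equivalent_refl;
        apply kuroda_reduction_equivalent; constructor.
Qed.

(** [Red] is abstract so that one induction serves both the four listed reductions and those induced
    by the two families of transforms. *)
Lemma Ki_reduces_to_lKu {Sg} (Red : form Sg -> form Sg -> Prop) :
  (forall P Z, ~ Red (¬ ¬ Atom P) Z) ->
  (forall o A B, root_step Red
     (neg2 (bin_transform neg2 Ki_transforms o A B))
     (neg2 (bin_transform neg2 lKu_transforms o A B))) ->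
  (forall q A, root_step Red
     (neg2 (un_transform neg2 Ki_transforms q A))
     (neg2 (un_transform neg2 lKu_transforms q A))) ->
  forall A, reduces_from_inside neg2 Ki_transforms Red A (Ki A) (lKu A).
Proof.
  intros Hatom Hbin Hun A. unfold reduces_from_inside.
  change (Ki A) with (neg2 (Ki_in A)).
  induction A as [P|o A IHA B IHB|q A IHA].
  - eapply rp_T; [apply rp_atom|]. right. split; [apply Hatom|reflexivity].
  (* All slots of [Ki_transforms] are [UseT], so the induction hypotheses fit the arguments as they
     stand. *)
  - eapply rp_T; [apply (@rp_bin _ _ Ki_transforms); [exact IHA|exact IHB]|].
    destruct o;
      [apply (Hbin Tensor)|apply (Hbin With)|apply (Hbin Plus)|apply (Hbin Lolli)].
  - eapply rp_T; [apply (@rp_un _ _ Ki_transforms); exact IHA|].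
    destruct q; [apply (Hun All)|apply (Hun Ex)|apply (Hun Bang)].
Qed.

(** * Soundness *)

(** With DNE, a double negation may be put in front of any subformula. *)
Lemma lKu_in_equivalent {Sg} (A : form Sg) : equivalent (CLLb Sg) A (lKu_in A).
Proof.
  assert (stable : forall A B : form Sg,
             equivalent (CLLb Sg) A B -> equivalent (CLLb Sg) A (¬ ¬ B)).
  { intros X Y H. eapply equivalent_trans; [exact H|]. apply equivalent_iff.
    split; [apply neg2_intro, d_id|apply d_ax, dne]. }
  induction A as [P|o A IHA B IHB|q A IHA].
  - apply equivalent_refl.
  - destruct o; apply equivalent_bin; auto.
  - destruct q; apply equivalent_un; auto.
Qed.

(** An empty right-hand side is read as ⊥, which [lKu_in] fixes, so both kinds of sequent share one
    translated form. *)
Definition succedent {Sg} (C : option (form Sg)) : form Sg :=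
  match C with Some A => A | None => Atom Bot end.

Lemma lKu_derivation {Sg} (Ax : system Sg) Γ C :
  CLLb Sg Γ C ->
  map lKu_in Γ ⊢[Ax] ¬ ¬ lKu_in (succedent C).
Proof.
  induction 1; simpl in *; rewrite ?map_app.
  - destruct H as [A]. simpl.
    (* [(¬¬A)_lKu] is [(A_lKu ⊸ ¬¬⊥) ⊸ ¬¬⊥]. *)
    apply d_lolliR, derivable_swap.
    apply (@d_lolliL _ _ [_] []).
    (* [¬ A_lKu] yields the antecedent [A_lKu ⊸ ¬¬⊥]; the [¬¬⊥] so obtained gives ⊥ because [⊥ ⊸ ⊥]
       is provable. *)
    + apply d_lolliR, neg2_intro, lolli_inv, d_id.
    + apply (@d_lolliL _ _ [] []); [apply d_lolliR|]; apply d_id.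
  - eapply d_perm; [apply Permutation_map; eassumption|assumption].
  - apply neg2_intro, d_id.
  - eapply neg2_cut; eassumption.
  - apply neg2_intro, d_oneR.
  - apply d_oneL; assumption.
  - apply neg2_intro, d_topR.
  - apply d_zeroL.
  - apply neg2_intro, d_id.
  - assumption.
  - apply neg2_tensor; assumption.
  - apply d_tensorL; assumption.
  - apply neg2_intro, d_lolliR; assumption.
  - apply neg2_lolliL; assumption.
  - apply neg2_intro, d_withR; assumption.
  - apply d_withL1, neg2_bind; assumption.
  - apply d_withL2, neg2_bind; assumption.
  - eapply neg2_map; [eassumption|apply d_plusR1, d_id].
  - eapply neg2_map; [eassumption|apply d_plusR2, d_id].
  - apply d_plusL; assumption.
  - apply neg2_intro, d_allR. rewrite <- lKu_in_map_shift. assumption.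
  - apply d_allL with t, neg2_bind.
    unfold inst in *. rewrite lKu_in_subst in *. assumption.
  - eapply neg2_map; [eassumption|]. apply d_exR with t.
    unfold inst. rewrite lKu_in_subst. apply d_id.
  - apply d_exL. rewrite <- lKu_in_map_shift. simpl.
    (* Shifting commutes with the translation and leaves the ⊥ of an empty succedent fixed. *)
    replace (shift (¬ ¬ lKu_in (succedent C)))
      with (¬ ¬ lKu_in (succedent (option_map shift C))); [assumption|].
    destruct C; [|reflexivity]. simpl. unfold shift.
    rewrite lKu_in_subst. reflexivity.
  - apply d_bangC; assumption.
  - apply d_bangW; assumption.
  - apply neg2_intro. rewrite map_map in *. simpl in *.
    (* The translated context consists of formulas [!¬¬A_lKu], so promotion still applies. *)
    rewrite <- (map_map (fun A => ¬ ¬ lKu_in A) (Un Bang)) in *.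
    apply d_bangR; assumption.
  - apply d_bangL, neg2_bind; assumption.
Qed.

Lemma lKu_sound {Sg} : sound (CLLb Sg) (ILLbot Sg) lKu.
Proof.
  split.
  - intros A H. exact (lKu_derivation _ _ _ H).
  - intros A. eapply equivalent_trans; [apply lKu_in_equivalent|].
    apply equivalent_iff. split; [apply neg2_intro, d_id|apply d_ax, dne].
Qed.

Lemma Ki_sound {Sg} : sound (CLLb Sg) (ILLbot Sg) Ki.
Proof.
  destruct (@lKu_sound Sg) as [Hder Heq]. split.
  - intros A H. rewrite <- (app_nil_r []).
    eapply d_cut; [apply Hder, H|].
    apply (equivalent_iff _ (Ki A)), Ki_lKu_equivalent.
  - intros A. eapply equivalent_trans; [apply Heq|].
    apply equivalent_sym, Ki_lKu_equivalent.
Qed.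

(** * Simplification and simplification from inside *)

Lemma lKu_simplification_Ki {Sg} :
  simplification (CLLb Sg) (ILLbot Sg) neg2
    lKu_transforms lKu Ki_transforms Ki.
Proof.
  repeat split.
  - exists lKu_in. repeat split; [intros []|intros []]; reflexivity.
  - exists Ki_in. repeat split.
  - apply Ki_sound.
  - apply Ki_sound.
  - apply lKu_sound.
  - apply lKu_sound.
  - apply Ki_lKu_equivalent.
  - unfold bin_simpler, bin_covers. intros []; simpl; intuition discriminate.
  - unfold un_simpler, un_covers. intros []; simpl; intuition discriminate.
  (* ⊗ witnesses strictness: it loses both inner double negations. *)
  - left. exists Tensor. unfold bin_simpler, bin_covers. simpl.
    intuition discriminate.
Qed.

Theorem proposition13 (Sg : signature) :
  (forall A : form Sg,
     reduces_from_inside neg2 Ki_transforms kuroda_reduction A (Ki A) (lKu A)) /\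
  simplification_from_inside (CLLb Sg) (ILLbot Sg) neg2
    lKu_transforms lKu Ki_transforms Ki /\
  (forall X Y : form Sg, kuroda_reduction X Y -> equivalent (ILLbot Sg) X Y).
Proof.
  split; [|split; [split|]].
  - apply Ki_reduces_to_lKu.
    + intros P Z H. inversion H.
    (* No listed reduction matches &, nor ∀ and ! below, so there the root stays unchanged. *)
    + intros [] A B; try (left; constructor);
        (right; split; [intros Z H; inversion H|reflexivity]).
    + intros [] A; try (left; constructor);
        (right; split; [intros Z H; inversion H|reflexivity]).
  - apply lKu_simplification_Ki.
  - apply Ki_reduces_to_lKu.
    + intros P Z H. inversion H.
    (* Here every connective has a reduction; where the transforms agree it maps the formula to
       itself. *)
    + left. constructor.
    + left. constructor.
  - intros X Y. apply kuroda_reduction_equivalent.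
Qed.
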